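(* Suppose that $\ell=p$ and $v(c)<0$. Let $r\in\mathbb{Z}_{\ge1}$ be such that $v(c)<-\frac{p}{(p^r-1)(p-1)}$. Then there exists a constant $C$ depending only on $p$, $r$, and $v(a)$ such that for all $n\ge 0$ $$[K_n:K]\le C\,B_n^{1-p^{-r}},$$ where $B_n=(p-1)\prod_{m=0}^{n-1}p^{p^m}$.
   Context: $p$ is a prime, $K$ is a finite extension of $\mathbb{Q}_p$ with valuation $v$ normalized by $v(p)=1$ and extended to an algebraic closure $\overline{K}$; $f(z)=z^p-c$ with $c\in K^\times$ (i.e. $\ell=p$ is the degree of $f$). $f^n$ is the $n$-th iterate of $f$; $a\in K$ is such that for every $n\ge0$ the solutions of $f^n(z)=a$ in $\overline{K}$ are distinct; $f^{-n}(a)$ is the set of these solutions; $K_n=K(f^{-n}(a))$. *)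

(* Defs.v *)
From HB Require Import structures.
From mathcomp Require Import all_boot all_order all_algebra all_field.
From mathcomp Require Import all_classical all_reals all_analysis.

Set Implicit Arguments.
Unset Strict Implicit.
Unset Printing Implicit Defensive.

Import Order.TTheory GRing.Theory Num.Theory.

Local Open Scope classical_set_scope.
Local Open Scope ring_scope.

(* Additive (exponential) valuations of rank one, with v 0 = +oo. *)
Record is_valuation (R : realType) (F : fieldType) (v : F -> \bar R) : Prop := {
  valuation0 : v 0 = +oo%E;
  valuation_fin : forall x : F, x != 0 -> v x \is a fin_num;
  valuationM : forall x y : F, v (x * y) = (v x + v y)%E;
  valuationD : forall x y : F, (Order.min (v x) (v y) <= v (x + y)%R)%E
}.

Definition padic_val (R : realType) (p : nat) (q : rat) : \bar R :=
  if q == 0 then +oo%E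
  else ((logn p `|numq q|%N)%:R - (logn p `|denq q|%N)%:R)%:E.

(* (Qp, vp) is a completion of the rationals for the p-adic valuation, which
   determines it up to a unique valuation-preserving isomorphism. Elements are
   close when the valuation of their difference is large. Since vp takes finite
   values on nonzero elements, the compatibility with padic_val forces characteristic 0, so
   that ratr is the embedding of rat. *)
Record is_Qp (R : realType) (p : nat) (Qp : fieldType) (vp : Qp -> \bar R) :
    Prop := {
  Qp_valuation : is_valuation vp;
  Qp_rat : forall q : rat, vp (ratr q) = padic_val R p q;
  Qp_dense : forall (x : Qp) (M : R),
    exists q : rat, (M%:E <= vp (x - ratr q)%R)%E;
  Qp_complete : forall u : nat -> Qp,
    (forall M : R, exists N : nat, forall m n : nat,
       (N <= m)%N -> (N <= n)%N -> (M%:E <= vp (u m - u n)%R)%E) ->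
    exists l : Qp, forall M : R, exists N : nat, forall n : nat,
      (N <= n)%N -> (M%:E <= vp (u n - l)%R)%E
}.

Definition is_algebraic_closure (K : fieldType) (L : closedFieldType)
    (iota : {rmorphism K -> L}) : Prop :=
  forall x : L, algebraicOver iota x.

(* The extension of K generated by S inside L: the smallest subfield of L
   containing the image of K and S. *)
Definition adjoin (K L : fieldType) (iota : {rmorphism K -> L}) (S : set L) :
    set L :=
  smallest (fun E : set L => GRing.divring_closed [in E]) (range iota `|` S).

(* [E : K] is finite and equal to d, i.e., E has a K-basis of d elements. *)
Definition has_degree (K L : fieldType) (iota : {rmorphism K -> L})
    (E : set L) (d : nat) : Prop :=
  exists e : 'I_d -> L, (forall i, E (e i)) /\
    forall x, E x ->
      exists! k : {ffun 'I_d -> K}, x = \sum_(i < d) iota (k i) * e i.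

Definition unicritical (A : nzRingType) (p : nat) (c z : A) : A := z ^+ p - c.

Definition preimages (L : fieldType) (p n : nat) (c a : L) : set L :=
  [set z | iter n (unicritical p c) z = a].

(* The roots of f^n(X) - a, listed with multiplicity, are pairwise distinct;
   f^n(X) is the n-th iterate of f in the polynomial ring, applied to 'X. *)
Definition distinct_preimages (L : fieldType) (p n : nat) (c a : L) : Prop :=
  exists2 rs : seq L, uniq rs &
    iter n (unicritical p c%:P) 'X - a%:P = \prod_(z <- rs) ('X - z%:P).

Definition preimage_field (K L : fieldType) (iota : {rmorphism K -> L})
    (p n : nat) (c a : K) : set L :=
  adjoin iota (preimages p n (iota c) (iota a)).

Definition Bn (p n : nat) : nat := (p.-1 * \prod_(0 <= m < n) p ^ (p ^ m))%N.

(* Main.v *)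
Require Import Defs.
From HB Require Import structures.
From mathcomp Require Import all_boot all_order all_algebra all_field.
From mathcomp Require Import all_classical all_reals all_analysis.
From mathcomp Require Import ring lra zify.

Set Implicit Arguments.
Unset Strict Implicit.
Unset Printing Implicit Defensive.

Import Order.TTheory GRing.Theory Num.Theory.

Local Open Scope classical_set_scope.
Local Open Scope ring_scope.

(** Write [f z = z ^+ p - c] and [K_n] for the field generated by [f^{-n}(a)].
    The field [K_{n+1}] is obtained from [K_n] by extracting the [p^n] roots
    of order [p] of the elements [c + w], where [w] runs over [f^{-n}(a)], and
    [K_n] contains the [p]-th roots of unity for [n >= 1], so a priori the degree can be
    multiplied by [p ^ (p ^ n)]. The saving comes from multiplicative relations
    modulo [p]-th powers. Fix [b] with [f^{n-r}(b) = a]. Then, up to a sign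
    which is a [p]-th power,
      [\prod_(f^r(w) = b) (c + w) = f^r(- c) - b = A ^+ p - d ^+ p],
    where [A = f^r(0)] and [d] is a preimage of [b], hence an element of [K_n].
    With [s = - v(c) > 0] the orbit of [0] escapes, [v(A) = - s p^{r-1}],
    whereas [v(d ^+ p) >= - s] once [n - r] is large, so that
    [(d / A) ^+ p] has valuation at least [s (p^r - 1)]. The hypothesis on
    [v(c)] says precisely that this exceeds [p / (p - 1)], and then
    [1 - (d / A) ^+ p] is a [p]-th power in the complete field [K_n]. The
    product of the [c + w] over the fibre of [b] is thus a [p]-th power in
    [K_n] (lemma [fiber_product_root]), and one root in each of the [p^{n-r}]
    fibres is a consequence of the others: the degree is multiplied by at most
    [p ^ (p ^ n - p ^ (n - r))] (lemma [Kn_step_saving]).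

    How large [n - r] must be depends on [p], [r] and [v(a)] only: the valuation of a
    preimage of [b] is at least [min(v(c), v(b)) / p], so that the iterated
    preimages of [a] have valuation at least [v(c)] from a level [m] on, and
    [m] can be chosen from [v(a)] and the lower bound
    [p / ((p^r - 1) (p - 1))] of [s]. The constant [C] is a crude bound for
    the degree of [K_{m+r}].

    Two tools are developed over an abstract algebraic closure. Finite
    extensions are handled as sets with a finite spanning list over the base
    field, from which a basis is extracted. Finite extensions of [Qp] are
    complete (lemma [complete_finite_ext]), and an element of a complete field that
    is close to 1 is a [p]-th power (lemma [root_in_complete]). *)

(** * Subfields of a field, and the degree of a finite extension *)

(** The elementwise form of the closure property by which [adjoin] is defined. *)
Record subfield (L : fieldType) (E : set L) : Prop := {
  subfield1 : E 1;
  subfieldB : forall x y, E x -> E y -> E (x - y);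
  subfieldV : forall x y, E x -> E y -> E (x / y)
}.

Lemma subfieldP (L : fieldType) (E : set L) :
  subfield E <-> GRing.divring_closed [in E].
Proof.
split=> [[E1 EB EV]|[E1 EB EV]].
  split; first by rewrite inE.
  - by move=> x y; rewrite !inE; apply: EB.
  - by move=> x y; rewrite !inE; apply: EV.
split; first by move: E1; rewrite inE.
- by move=> x y Ex Ey; have := EB x y; rewrite !inE; apply.
- by move=> x y Ex Ey; have := EV x y; rewrite !inE; apply.
Qed.

Section Subfield.
Variables (L : fieldType) (E : set L).
Hypothesis subE : subfield E.

Lemma subfield0 : E 0.
Proof. by rewrite -(subrr 1); apply: (subfieldB subE); apply: subfield1. Qed.

Lemma subfieldN x : E x -> E (- x).
Proof. by move=> Ex; rewrite -sub0r; apply: subfieldB => //; apply: subfield0. Qed.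

Lemma subfieldD x y : E x -> E y -> E (x + y).
Proof.
by move=> Ex Ey; rewrite -[y]opprK; apply: subfieldB => //; apply: subfieldN.
Qed.

Lemma subfieldI x : E x -> E x^-1.
Proof. by move=> Ex; rewrite -div1r; apply: subfieldV => //; apply: subfield1. Qed.

Lemma subfieldM x y : E x -> E y -> E (x * y).
Proof.
by move=> Ex Ey; rewrite -[y]invrK; apply: subfieldV => //; apply: subfieldI.
Qed.

Lemma subfieldX x n : E x -> E (x ^+ n).
Proof.
move=> Ex; elim: n => [|n IHn]; first exact: subfield1.
by rewrite exprS; apply: subfieldM.
Qed.

Lemma subfield_nat n : E n%:R.
Proof.
elim: n => [|n IHn]; first exact: subfield0.
by rewrite -natr1; apply: subfieldD => //; apply: subfield1.
Qed.

Lemma subfield_sum (I : Type) (s : seq I) (P : pred I) (F : I -> L) :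
  (forall i, E (F i)) -> E (\sum_(i <- s | P i) F i).
Proof. by move=> EF; apply: (big_ind E) => //; [exact: subfield0|exact: subfieldD]. Qed.

Lemma subfield_prod (s : seq L) : (forall x, x \in s -> E x) ->
  E (\prod_(x <- s) x).
Proof.
move=> Es; rewrite big_seq; apply: (big_ind E) => //; first exact: subfield1.
exact: subfieldM.
Qed.

End Subfield.

Lemma subfield_range (K L : fieldType) (iota : {rmorphism K -> L}) :
  subfield (range iota).
Proof.
split; first by exists 1 => //; rewrite rmorph1.
- by move=> _ _ [x _ <-] [y _ <-]; exists (x - y) => //; rewrite rmorphB.
- by move=> _ _ [x _ <-] [y _ <-]; exists (x / y) => //; rewrite fmorph_div.
Qed.

Section Span.
Variable L : fieldType.
Implicit Types (F W : set L) (s t : seq L).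

Fixpoint span F s : set L :=
  if s is x :: s' then [set y | exists a w, [/\ F a, span F s' w & y = a * x + w]]
  else [set 0].

Variable F : set L.
Hypothesis subF : subfield F.

Lemma span0 s : span F s 0.
Proof.
elim: s => [|x s IHs] //=; exists 0, 0; split => //; first exact: subfield0.
by rewrite mul0r addr0.
Qed.

Lemma spanD s y z : span F s y -> span F s z -> span F s (y + z).
Proof.
elim: s y z => [|x s IHs] y z /=; first by move=> -> ->; rewrite addr0.
move=> [a [w [Fa sw ->]]] [b [u [Fb su ->]]]; exists (a + b), (w + u); split.
- exact: subfieldD.
- exact: IHs.
- by rewrite mulrDl addrACA.
Qed.

Lemma spanZ s a y : F a -> span F s y -> span F s (a * y).
Proof.
move=> Fa; elim: s y => [|x s IHs] y /=; first by move=> ->; rewrite mulr0.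
move=> [b [w [Fb sw ->]]]; exists (a * b), (a * w); split.
- exact: subfieldM.
- exact: IHs.
- by rewrite mulrDr mulrA.
Qed.

Lemma spanB s y z : span F s y -> span F s z -> span F s (y - z).
Proof.
move=> sy sz; rewrite -mulN1r; apply: spanD => //; apply: spanZ => //.
by apply: subfieldN => //; apply: subfield1.
Qed.

Lemma span_sum s (I : Type) (r : seq I) (P : pred I) (G : I -> L) :
  (forall i, span F s (G i)) -> span F s (\sum_(i <- r | P i) G i).
Proof. by move=> sG; apply: (big_ind (span F s)) => //; [exact: span0|exact: spanD]. Qed.

Lemma span_mem s x : x \in s -> span F s x.
Proof.
elim: s => [|y s IHs] //=; rewrite inE => /orP[/eqP ->|/IHs sx].
  by exists 1, 0; split; [exact: subfield1|exact: span0|rewrite mul1r addr0].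
by exists 0, x; split => //; [exact: subfield0|rewrite mul0r add0r].
Qed.

Lemma span_sub s W : W 0 -> (forall y z, W y -> W z -> W (y + z)) ->
  (forall a x, F a -> x \in s -> W (a * x)) -> span F s `<=` W.
Proof.
move=> W0 WD; elim: s => [|x s IHs] Ws y /=; first by move->.
move=> [a [w [Fa sw ->]]]; apply: WD; first by apply: Ws => //; rewrite mem_head.
by apply: IHs sw => b z Fb sz; apply: Ws => //; rewrite inE sz orbT.
Qed.

(** The tower law: products of spanning elements span the big extension. *)
Lemma span_tower s t : span (span F s) t = span F [seq x * y | y <- t, x <- s].
Proof.
have subs u w (sw : forall x, x \in u -> span F w x) : span F u `<=` span F w.
  apply: span_sub; [exact: span0|exact: spanD|move=> a x Fa /sw].
  exact: spanZ.
elim: t => [|y t IHt] //=; apply/seteqP; split=> z.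
  move=> [a [w [sa tw ->]]]; apply: spanD; last first.
    rewrite IHt in tw; apply: subs tw => x tx; apply: span_mem.
    by rewrite mem_cat tx orbT.
  have : [set a | span F ([seq x * y | x <- s] ++
      [seq x * y | y <- t, x <- s]) (a * y)] a; last by [].
  apply: span_sub sa => /=; first by rewrite mul0r; exact: span0.
  - by move=> b b' sb sb'; rewrite mulrDl; exact: spanD.
  move=> b x Fb sx; rewrite -mulrA; apply: spanZ => //; apply: span_mem.
  by rewrite mem_cat (map_f (fun x => x * y)).
move: z; apply: span_sub.
- exists 0, 0; split; [exact: span0|rewrite IHt; exact: span0|].
  by rewrite mul0r addr0.
- move=> u v [a [w [sa tw ->]]] [b [w' [sb tw' ->]]].
  exists (a + b), (w + w'); split; [exact: spanD| |by rewrite mulrDl addrACA].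
  by rewrite IHt in tw tw' *; exact: spanD.
move=> a x Fa; rewrite mem_cat => /orP[/mapP[u su ->]|tx].
  exists (a * u), 0; split; last by rewrite mulrA addr0.
    by apply: spanZ => //; apply: span_mem.
  by rewrite IHt; exact: span0.
exists 0, (a * x); split; [exact: span0| |by rewrite mul0r add0r].
by rewrite IHt; apply: spanZ => //; apply: span_mem.
Qed.

Lemma span_cons_mem s x : span F s x -> span F (x :: s) = span F s.
Proof.
move=> sx; apply/seteqP; split=> y /=.
  by move=> [a [w [Fa sw ->]]]; apply: spanD => //; apply: spanZ.
by move=> sy; exists 0, y; split=> //; [exact: subfield0|rewrite mul0r add0r].
Qed.

(** The recursive form matches that of [span], and avoids indices when an
    element that depends on the next ones is discarded. *)
Fixpoint indep s : Prop :=
  if s is x :: s' then ~ span F s' x /\ indep s' else True.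

Lemma span_indep s :
  exists t, [/\ indep t, (size t <= size s)%N & span F t = span F s].
Proof.
elim: s => [|x s [t [it ts eq_ts]]]; first by exists [::].
have [tx|ntx] := pselect (span F t x).
  exists t; split => //; first exact: leqW.
  by rewrite span_cons_mem // -eq_ts.
exists (x :: t); split => //=.
by apply/seteqP; split=> y /=; rewrite eq_ts.
Qed.

End Span.

Section Degree.
Variables (K L : fieldType) (iota : {rmorphism K -> L}).
Let F := range iota.
Let subF : subfield F := subfield_range iota.

Lemma span_coord s y : span F s y ->
  exists k : 'I_(size s) -> K, y = \sum_i iota (k i) * s`_i.
Proof.
elim: s y => [|x s IHs] y /=.
  by move->; exists (fun=> 0); rewrite big_ord0.
move=> [_ [w [[a _ <-] /IHs[k ->] ->]]].
exists (fun i => if unlift ord0 i is Some j then k j else a).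
rewrite big_ord_recl unlift_none; congr (_ + _).
by apply: eq_bigr => i _; rewrite liftK.
Qed.

Lemma coord_span s (k : 'I_(size s) -> K) :
  span F s (\sum_i iota (k i) * s`_i).
Proof.
apply: span_sum => // i; apply: spanZ => //; first by exists (k i).
by apply: span_mem => //; apply: mem_nth.
Qed.

Lemma indep_coord s (k l : 'I_(size s) -> K) : indep F s ->
  \sum_i iota (k i) * s`_i = \sum_i iota (l i) * s`_i -> k =1 l.
Proof.
elim: s k l => [|x s IHs] k l /=; first by move=> _ _ [].
move=> [nx is_]; rewrite !big_ord_recl /= => eqkl.
have eq0 : k ord0 = l ord0.
  apply/eqP/negPn/negP => nkl; apply: nx.
  have dn0 : iota (k ord0 - l ord0) != 0 by rewrite fmorph_eq0 subr_eq0.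
  have -> : x = (iota (k ord0 - l ord0))^-1 *
      (\sum_i iota (l (lift ord0 i)) * s`_i -
       \sum_i iota (k (lift ord0 i)) * s`_i).
    apply: (mulfI dn0); rewrite mulrA mulfV // mul1r rmorphB mulrBl.
    by apply/eqP; rewrite subr_eq addrAC eq_sym subr_eq addrC eqkl addrC.
  apply: spanZ => //; first by apply: subfieldI => //; exists (k ord0 - l ord0).
  by apply: spanB => //; apply: coord_span.
move: eqkl; rewrite eq0 => /addrI eqs i.
by case: (unliftP ord0 i) => [j|] -> //; apply: (IHs (k \o _) (l \o _)).
Qed.

Lemma span_degree s :
  exists2 d, has_degree iota (span F s) d & (d <= size s)%N.
Proof.
have [t [it ts <-]] := span_indep subF s.
exists (size t) => //; exists (fun i => t`_i); split=> [i|x /span_coord[k ->]].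
  by apply: span_mem => //; apply: mem_nth.
exists [ffun i => k i]; split; first by apply: eq_bigr => i _; rewrite ffunE.
move=> l eqkl; apply/ffunP; rewrite -/(_ =1 _).
apply: indep_coord it _; rewrite -eqkl.
by apply: eq_bigr => i _; rewrite ffunE.
Qed.

(** An algebraic [x != 0] satisfies an equation with nonzero constant term, so
    its inverse is a polynomial in [x]. *)
Lemma algebraic_subring (E : set L) : (forall x, algebraicOver iota x) ->
  F `<=` E -> (forall x y, E x -> E y -> E (x - y)) ->
  (forall x y, E x -> E y -> E (x * y)) -> subfield E.
Proof.
move=> alg FE EB EM.
have E1 : E 1 by apply: FE; apply: subfield1.
have E0 : E 0 by apply: FE; apply: subfield0.
have ED x y : E x -> E y -> E (x + y).
  by move=> Ex Ey; rewrite -[y]opprK -[- y]sub0r; apply: (EB) => //; apply: EB.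
suff EI x : E x -> E x^-1 by split => // x y Ex /EI; apply: EM.
move=> Ex; have [->|xn0] := eqVneq x 0; first by rewrite invr0.
have [q] := alg x; elim/poly_ind: q => [|q c IHq]; first by rewrite eqxx.
move=> qn0; rewrite rmorphD rmorphM /= map_polyX map_polyC /= rootE.
rewrite hornerD hornerMX hornerC => /eqP eq0.
have Eq : E (map_poly iota q).[x].
  rewrite horner_coef; apply: (big_ind E) => // i _; apply: (EM).
    by rewrite coef_map; apply: (FE); exists q`_i.
  by elim: (nat_of_ord i) => [|j IHj] //; rewrite exprS; apply: (EM) => //.
have [c0|cn0] := eqVneq c 0.
  apply: IHq.
    by apply: contraNneq qn0 => ->; rewrite c0 mul0r add0r.
  by move: eq0; rewrite c0 rmorph0 addr0 rootE => /eqP; rewrite mulf_eq0 (negPf xn0) orbF.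
have icn0 : iota c != 0 by rewrite fmorph_eq0.
have -> : x^-1 = (0 - (map_poly iota q).[x]) * iota c^-1.
  apply: (mulIf xn0); rewrite mulVf // sub0r mulrAC mulNr.
  move/eqP: eq0; rewrite addrC addr_eq0 => /eqP <-.
  by rewrite fmorphV mulfV.
by apply: EM; [apply: EB|apply: FE; exists c^-1].
Qed.

End Degree.

Section FiniteExtension.
Variables (K L : fieldType) (iota : {rmorphism K -> L}).
Hypothesis alg : forall x, algebraicOver iota x.
Implicit Types E W : set L.

Definition degree_le E (N : nat) : Prop :=
  [/\ subfield E, range iota `<=` E &
      exists2 s, (size s <= N)%N & E = span (range iota) s].

Lemma degree_le_has E N : degree_le E N ->
  exists2 d, has_degree iota E d & (d <= N)%N.
Proof.
move=> [_ _ [s sN ->]]; have [d dP ds] := span_degree iota s.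
by exists d => //; apply: leq_trans ds sN.
Qed.

Lemma degree_le_base : degree_le (range iota) 1.
Proof.
split=> //; first exact: subfield_range.
exists [:: 1] => //; apply/seteqP; split=> x /=.
  by move=> Fx; exists x, 0; rewrite mulr1 addr0.
by move=> [a [w [Fa -> ->]]]; rewrite mulr1 addr0.
Qed.

(** The extension [E[z]] is the [E]-span of [1, z, ..., z^(p-1)]. *)
Lemma degree_le_root E N p z : degree_le E N -> (0 < p)%N -> E (z ^+ p) ->
  exists E', [/\ degree_le E' (N * p), E `<=` E', E' z &
    forall W, subfield W -> E `<=` W -> W z -> E' `<=` W].
Proof.
move=> [subE KE [s sN eqE]] p0 Ezp.
pose E' := [set x | exists2 q : {poly L}, (forall i, E q`_i) & x = q.[z]].
have EE' : E `<=` E'.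
  move=> x Ex; exists x%:P; last by rewrite hornerC.
  by move=> i; rewrite coefC; case: ifP => // _; apply: subfield0.
exists E'; split => //.
- split; last first.
  + exists [seq x * y | y <- [seq z ^+ i | i <- seq.iota 0 p], x <- s].
      by rewrite size_allpairs size_map size_iota mulnC leq_mul2r sN orbT.
    rewrite -span_tower; last exact: subfield_range.
    rewrite -eqE; set t := map _ _.
    have tz i : span E t (z ^+ i).
      rewrite (divn_eq i p) exprD mulnC exprM; apply: spanZ => //.
        exact: subfieldX.
      apply: span_mem => //; apply: map_f.
      by rewrite mem_iota /= add0n ltn_mod.
    apply/seteqP; split=> x.
      move=> [q Eq ->]; rewrite horner_coef; apply: span_sum => // i.
      by apply: spanZ.
    apply: span_sub; first by apply: (EE'); apply: subfield0.
      move=> _ _ [q Eq ->] [q' Eq' ->]; exists (q + q'); last by rewrite hornerD.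
      by move=> i; rewrite coefD; apply: subfieldD.
    move=> a _ Ea /mapP[i _ ->]; exists (a *: 'X^i); last first.
      by rewrite hornerZ hornerXn.
    move=> j; rewrite coefZ coefXn; apply: subfieldM => //.
    exact: subfield_nat.
  + exact: subset_trans (EE').
  + apply: (@algebraic_subring _ _ iota) => //.
    * exact: subset_trans (EE').
    * move=> _ _ [q Eq ->] [q' Eq' ->]; exists (q - q'); last by rewrite hornerD hornerN.
      by move=> i; rewrite coefB; apply: subfieldB.
    * move=> _ _ [q Eq ->] [q' Eq' ->]; exists (q * q'); last by rewrite hornerM.
      move=> i; rewrite coefM; apply: subfield_sum => // j.
      exact: subfieldM.
- by exists 'X; [move=> i; rewrite coefX; apply: subfield_nat|rewrite hornerX].
move=> W subW EW Wz _ [q Eq ->]; rewrite horner_coef.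
apply: subfield_sum => // i; apply: subfieldM => //; first exact: EW.
exact: subfieldX.
Qed.

(** The last clause makes the extension the smallest one, so that it can be
    recognised as a field defined by generators. *)
Lemma degree_le_roots E N p (zs : seq L) : degree_le E N -> (0 < p)%N ->
  (forall z, z \in zs -> E (z ^+ p)) ->
  exists E', [/\ degree_le E' (N * p ^ size zs), E `<=` E',
    forall z, z \in zs -> E' z &
    forall W, subfield W -> E `<=` W -> (forall z, z \in zs -> W z) -> E' `<=` W].
Proof.
move=> EN p0; elim: zs => [|z zs IHzs] Ezs.
  by exists E; split => //=; rewrite muln1.
case: IHzs => [w zsw|E1 [E1N EE1 E1zs E1min]].
  by apply: Ezs; rewrite inE zsw orbT.
have [|E2 [E2N E12 E2z E2min]] := @degree_le_root E1 _ p z E1N p0.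
  by apply: EE1; apply: Ezs; rewrite mem_head.
exists E2; split => //=; first by rewrite expnS [(p * _)%N]mulnC mulnA.
- exact: subset_trans E12.
- by move=> w; rewrite inE => /orP[/eqP ->//|/E1zs/E12].
move=> W subW EW Wzs; apply: E2min => //; last by apply: Wzs; rewrite mem_head.
by apply: E1min => // w zsw; apply: Wzs; rewrite inE zsw orbT.
Qed.

End FiniteExtension.

(** * Valuations and completeness *)

Section Valuation.
Variables (R : realType) (L : fieldType) (v : L -> \bar R).
Hypothesis hv : is_valuation v.
Implicit Types (x y z : L) (M t : R).

Lemma val_real x : x != 0 -> exists t, v x = t%:E.
Proof. by move=> /(valuation_fin hv) vx; exists (fine (v x)); rewrite fineK. Qed.

Lemma vge0 M : (M%:E <= v 0)%E.
Proof. by rewrite (valuation0 hv) leey. Qed.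

(** Lower bounds [M <= v x] behave well for [x = 0]; this turns the failure of
    such a bound into a real valuation. *)
Lemma vge_lt x M : ~ (M%:E <= v x)%E -> exists2 t, v x = t%:E & t < M.
Proof.
have [->|/val_real[t ->]] := eqVneq x 0; first by move/(_ (vge0 M)).
by rewrite lee_fin => /negP; rewrite -ltNge; exists t.
Qed.

Lemma vge_all x : (forall M, M%:E <= v x)%E -> x = 0.
Proof.
move=> vx; apply/eqP/negPn/negP => /val_real[t vt].
by have := vx (t + 1); rewrite vt lee_fin; lra.
Qed.

Lemma vgeW x M N : N <= M -> (M%:E <= v x)%E -> (N%:E <= v x)%E.
Proof. by move=> NM; apply: le_trans; rewrite lee_fin. Qed.

Lemma vgeM x y M N : (M%:E <= v x)%E -> (N%:E <= v y)%E ->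
  ((M + N)%:E <= v (x * y)%R)%E.
Proof. by move=> Mx Ny; rewrite (valuationM hv) EFinD leeD. Qed.

Lemma val1 : v 1 = 0%E.
Proof.
have [t v1] := val_real (oner_neq0 L).
have := valuationM hv 1 1; rewrite mulr1 v1 -EFinD => -[tt].
by congr EFin; lra.
Qed.

Lemma valN x : v (- x) = v x.
Proof.
have n1 : -1 != 0 :> L by rewrite oppr_eq0 oner_neq0.
have [t vN1] := val_real n1.
have := valuationM hv (-1) (-1); rewrite mulrNN mulr1 val1 vN1 -EFinD => -[tt].
by rewrite -mulN1r (valuationM hv) vN1 (_ : t = 0) ?add0e //; lra.
Qed.

Lemma vgeD x y M : (M%:E <= v x)%E -> (M%:E <= v y)%E -> (M%:E <= v (x + y)%R)%E.
Proof.
by move=> Mx My; apply: le_trans (valuationD hv x y); rewrite le_min Mx.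
Qed.

Lemma vgeN x M : (M%:E <= v x)%E -> (M%:E <= v (- x)%R)%E.
Proof. by rewrite valN. Qed.

Lemma vgeB x y M : (M%:E <= v x)%E -> (M%:E <= v y)%E -> (M%:E <= v (x - y)%R)%E.
Proof. by move=> Mx /vgeN; apply: vgeD. Qed.

Lemma vge_sum (I : Type) (s : seq I) (P : pred I) (F : I -> L) M :
  (forall i, P i -> M%:E <= v (F i))%E -> (M%:E <= v (\sum_(i <- s | P i) F i)%R)%E.
Proof.
move=> MF; apply: (big_ind (fun x => M%:E <= v x)%E) => //; first exact: vge0.
by move=> x y; apply: vgeD.
Qed.

Lemma vge_nat n : (0%:E <= v n%:R)%E.
Proof.
elim: n => [|n IHn]; first exact: vge0.
by rewrite -natr1; apply: vgeD => //; rewrite val1.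
Qed.

Lemma valX x t n : v x = t%:E -> v (x ^+ n) = (t * n%:R)%:E.
Proof.
move=> vx; elim: n => [|n IHn]; first by rewrite val1 mulr0.
by rewrite exprS (valuationM hv) IHn vx -EFinD -natr1 mulrDr mulr1 addrC.
Qed.

Lemma vgeX x M n : (M%:E <= v x)%E -> ((M * n%:R)%:E <= v (x ^+ n)%R)%E.
Proof.
move=> Mx; elim: n => [|n IHn]; first by rewrite val1 mulr0.
by rewrite exprS -natr1 mulrDr mulr1 addrC; apply: vgeM.
Qed.

Lemma valV x t : v x = t%:E -> v x^-1 = (- t)%:E.
Proof.
move=> vx; have xn0 : x != 0.
  by apply/eqP => x0; move: vx; rewrite x0 (valuation0 hv).
have [t' vV] : exists t', v x^-1 = t'%:E by apply: val_real; rewrite invr_eq0.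
have := valuationM hv x x^-1; rewrite mulfV // val1 vx vV -EFinD => -[tt'].
by congr EFin; lra.
Qed.

Lemma valD_lt x y : (v x < v y)%E -> v (x + y) = v x.
Proof.
move=> xy; apply/eqP; rewrite eq_le; apply/andP; split.
  rewrite leNgt; apply/negP => xDy; have := valuationD hv (x + y) (- y).
  by rewrite addrK valN ge_min !leNgt xDy xy.
by apply: le_trans (valuationD hv x y); rewrite le_min lexx ltW.
Qed.

Lemma nat_above M : exists n, forall m, (n <= m)%N -> M <= m%:R.
Proof.
exists (Num.bound `|M|) => m nm; apply: le_trans (ler_norm M) _.
by apply: le_trans (ltW (archi_boundP (normr_ge0 M))) _; rewrite ler_nat.
Qed.

Definition cauchy_seq (u : nat -> L) := forall M, exists N, forall m n,
  (N <= m)%N -> (N <= n)%N -> (M%:E <= v (u m - u n))%E.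

Definition tends_to (u : nat -> L) l := forall M, exists N, forall n,
  (N <= n)%N -> (M%:E <= v (u n - l))%E.

Definition complete_set (S : set L) := forall u : nat -> L,
  (forall n, S (u n)) -> cauchy_seq u -> exists2 l, S l & tends_to u l.

(** A complete set is closed: points of [S] ever closer to [z] would form a
    Cauchy sequence with limit [z]. *)
Lemma complete_far S z : complete_set S -> ~ S z ->
  exists M, forall w, S w -> ~ (M%:E <= v (z - w)%R)%E.
Proof.
move=> cS nSz; apply: contrapT => nM.
have /choice[u uP] : forall k, exists w, S w /\ (k%:R%:E <= v (z - w)%R)%E.
  move=> k; apply: contrapT => nw; apply: nM; exists k%:R => w Sw wk.
  by apply: nw; exists w.
have u_near M : exists N, forall n, (N <= n)%N -> (M%:E <= v (z - u n)%R)%E.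
  have [N MN] := nat_above M; exists N => n Nn.
  by apply: vgeW (MN n Nn) _; have [] := uP n.
have [||l Sl ul] := cS u; first by move=> n; have [] := uP n.
  move=> M; have [N uN] := u_near M; exists N => m n Nm Nn.
  have -> : u m - u n = (z - u n) - (z - u m) by ring.
  by apply: vgeB; apply: uN.
apply: nSz; suff -> : z = l by [].
apply/eqP; rewrite -subr_eq0; apply/eqP; apply: vge_all => M.
have [[N1 uN1] [N2 uN2]] := (u_near M, ul M).
have -> : z - l = (z - u (maxn N1 N2)) + (u (maxn N1 N2) - l) by ring.
by apply: vgeD; [apply: uN1; apply: leq_maxl|apply: uN2; apply: leq_maxr].
Qed.

(** If [z] keeps a bounded distance from the span of [s], then the coefficient
    of [z] in a combination is controlled by the valuation of the whole
    combination, so that coefficients of a Cauchy sequence are Cauchy. *)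
Lemma complete_span F s : subfield F -> complete_set F ->
  complete_set (span F s).
Proof.
move=> subF cF; elim: s => [|z s IHs].
  move=> u u0 _; exists 0 => // M; exists 0%N => n _.
  by rewrite (u0 n) subr0; apply: vge0.
have [sz|nsz] := pselect (span F s z); first by rewrite span_cons_mem.
have [M0 far] := complete_far IHs nsz.
have zn0 : z != 0 by apply: contra_notN nsz => /eqP ->; apply: span0.
have [tz vz] := val_real zn0.
have coef_ge a w M : F a -> span F s w -> (M%:E <= v (a * z + w)%R)%E ->
    ((M - M0)%:E <= v a)%E.
  move=> Fa sw; have [->|an0] := eqVneq a 0; first by rewrite vge0.
  have [ta va] := val_real an0.
  have [|t vt tM0] := @vge_lt (z - - a^-1 * w) M0.
    by apply: far; apply: spanZ => //; apply: subfieldN => //; apply: subfieldI.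
  have -> : a * z + w = a * (z - - a^-1 * w) by field.
  rewrite (valuationM hv) va vt -EFinD !lee_fin; lra.
move=> u su cu.
have /choice[aw awP] : forall n, exists aw : L * L,
    [/\ F aw.1, span F s aw.2 & u n = aw.1 * z + aw.2].
  by move=> n; have [a [w awP]] := su n; exists (a, w).
pose a n := (aw n).1; pose w n := (aw n).2.
have ca : cauchy_seq a.
  move=> M; have [N uN] := cu (M + M0); exists N => m n Nm Nn.
  have [[Fm sm um] [Fn sn un]] := (awP m, awP n).
  rewrite -[M](addrK M0); apply: (@coef_ge _ (w m - w n)).
  - exact: subfieldB.
  - exact: spanB.
  have -> : (a m - a n) * z + (w m - w n) = u m - u n.
    by rewrite um un /a /w; ring.
  exact: uN.
have [n|la Fla ala] := cF a _ ca; first by have [] := awP n.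
have cw : cauchy_seq w.
  move=> M; have [[N1 uN] [N2 aN]] := (cu M, ca (M - tz)).
  exists (maxn N1 N2) => m n; rewrite !geq_max => /andP[m1 m2] /andP[n1 n2].
  have [[_ _ um] [_ _ un]] := (awP m, awP n).
  have -> : w m - w n = (u m - u n) - (a m - a n) * z.
    by rewrite um un /a /w; ring.
  apply: vgeB; first exact: uN.
  by rewrite -[M](subrK tz); apply: vgeM; [apply: aN|rewrite vz].
have [n|lw slw wlw] := IHs w _ cw; first by have [] := awP n.
exists (la * z + lw); first by exists la, lw.
move=> M; have [[N1 aN] [N2 wN]] := (ala (M - tz), wlw M).
exists (maxn N1 N2) => n; rewrite geq_max => /andP[n1 n2].
have [_ _ ->] := awP n.
have -> : (aw n).1 * z + (aw n).2 - (la * z + lw) =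
    (a n - la) * z + (w n - lw) by rewrite /a /w; ring.
apply: vgeD; last exact: wN.
by rewrite -[M](subrK tz); apply: vgeM; [apply: aN|rewrite vz].
Qed.

(** * Roots of elements close to 1 *)

(** In the binomial expansion of [(y + t) ^+ p] the terms of degree 0 and 1 in
    [t] add up to [b]. The terms of degree between 2 and [p - 1] are divisible
    by [p] and give the bound [2 * N - 1]; the term [t ^+ p] gives the other
    bound. *)
Lemma newton_step p (b y : L) N : prime p -> v p%:R = 1%:E -> 1 <= N ->
  v y = 0%:E -> (N%:E <= v (b - y ^+ p)%R)%E ->
  let t := (b - y ^+ p) / (p%:R * y ^+ p.-1) in
  ((N - 1)%:E <= v t)%E /\
  ((Num.min (2 * N - 1) (p%:R * N - p%:R))%:E <= v (b - (y + t) ^+ p)%R)%E.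
Proof.
move=> pp vp N1 vy vN t.
have pn0 : p%:R != 0 :> L.
  by apply/eqP => p0; move: vp; rewrite p0 (valuation0 hv).
have yn0 : y != 0 by apply/eqP => y0; move: vy; rewrite y0 (valuation0 hv).
have vt : ((N - 1)%:E <= v t)%E.
  apply: vgeM => //; rewrite (@valV _ 1) // (valuationM hv) vp (valX _ vy).
  by rewrite mul0r adde0.
split => //.
have -> : b - (y + t) ^+ p =
    - \sum_(2 <= m < p.+1) y ^+ (p - m) * t ^+ m *+ 'C(p, m).
  rewrite exprDn -(big_mkord xpredT (fun m => y ^+ (p - m) * t ^+ m *+ 'C(p, m))).
  rewrite big_ltn // big_ltn ?ltnS ?prime_gt0 // subn0 expr0 mulr1 bin0 mulr1n.
  rewrite expr1 bin1 subn1 -mulr_natl.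
  have -> : p%:R * (y ^+ p.-1 * t) = b - y ^+ p.
    by rewrite /t; field; rewrite pn0 expf_neq0.
  by rewrite addrA [y ^+ p + _]addrC subrK opprD addrA subrr add0r.
apply: vgeN; rewrite big_nat; apply: vge_sum => m /andP[m2 mp].
have tm : (((N - 1) * m%:R)%:E <= v (t ^+ m))%E by apply: vgeX.
have ym : v (y ^+ (p - m)) = 0%:E by rewrite (valX _ vy) mul0r.
move: mp; rewrite ltnS leq_eqVlt => /orP[/eqP ->|mp].
  rewrite subnn expr0 mul1r binn mulr1n.
  apply: vgeW (vgeX p vt); rewrite ge_min; apply/orP; right.
  by rewrite mulrBl mul1r mulrC.
have /dvdnP[k ->] : (p %| 'C(p, m))%N by apply: prime_dvd_bin => //; rewrite mp (ltnW m2).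
rewrite mulnC -[_ *+ (p * k)]mulr_natl natrM -mulrA.
have -> : Num.min (2 * N - 1) (p%:R * N - p%:R) =
   1 + (Num.min (2 * N - 1) (p%:R * N - p%:R) - 1) by ring.
apply: vgeM; first by rewrite vp.
apply: vgeW (vgeM (vge_nat k) (vgeM (_ : 0%:E <= v (y ^+ (p - m)))%E tm)).
  have mR : 2 <= m%:R :> R by rewrite ler_nat.
  have : Num.min (2 * N - 1) (p%:R * N - p%:R) <= 2 * N - 1 by rewrite ge_min lexx.
  by nra.
by rewrite ym.
Qed.

(** Both bounds of the Newton step improve [N] by a fixed positive amount, for
    all [N >= rho], as soon as [rho > p / (p - 1)]. *)
Lemma root_approx p E b rho : prime p -> v p%:R = 1%:E -> subfield E -> E b ->
  p%:R / (p%:R - 1) < rho -> (rho%:E <= v (b - 1)%R)%E ->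
  forall M, exists2 y, E y & (M%:E <= v (b - y ^+ p)%R)%E.
Proof.
move=> pp vp subE Eb rho_gt vb.
have p2 : 2 <= p%:R :> R by rewrite ler_nat prime_gt1.
have rho1 : 1 < rho.
  by apply: lt_trans rho_gt; rewrite ltr_pdivlMr; lra.
have rhop : p%:R < rho * (p%:R - 1) by rewrite -ltr_pdivrMr //; lra.
pose e := Num.min (rho - 1) (rho * (p%:R - 1) - p%:R).
have e0 : 0 < e by rewrite lt_min; apply/andP; split; lra.
have e1 : e <= rho - 1 by rewrite ge_min lexx.
have e2 : e <= rho * (p%:R - 1) - p%:R by rewrite ge_min lexx orbT.
(* [e] bounds from below the gain of one Newton step from any [N >= rho]. *)
have approx k : exists y,
    [/\ E y, v y = 0%:E & ((rho + k%:R * e)%:E <= v (b - y ^+ p)%R)%E].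
  elim: k => [|k [y [Ey vy vk]]].
    exists 1; split; [exact: subfield1|exact: val1|].
    by rewrite expr1n mul0r addr0.
  have ke : 0 <= k%:R * e by apply: mulr_ge0 => //; apply: ltW.
  set N := rho + _ in vk.
  have [|vt vt'] := newton_step pp vp _ vy vk; first by rewrite /N; lra.
  set t := _ / _ in vt vt'; exists (y + t); split.
  - apply: subfieldD => //; apply: subfieldV => //.
      by apply: subfieldB => //; apply: subfieldX.
    by apply: subfieldM => //; [apply: subfield_nat|apply: subfieldX].
  - rewrite valD_lt vy //; apply: lt_le_trans vt; rewrite lte_fin /N; lra.
  - apply: vgeW vt'; rewrite le_min -natr1 /N; apply/andP; split; nra.
move=> M; have [k kM] := nat_above ((M - rho) / e).
have [y [Ey _ vk]] := approx k; exists y => //; apply: vgeW vk.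
by have := kM k (leqnn k); rewrite ler_pdivrMr //; lra.
Qed.

End Valuation.

Lemma XnsubC_roots (L : closedFieldType) p (b : L) : (0 < p)%N ->
  exists2 rs : seq L, size rs = p &
    forall x, x ^+ p - b = \prod_(z <- rs) (x - z).
Proof.
move=> p0; have [rs def] := closed_field_poly_normal ('X^p - b%:P).
have mon := monicXnsubC b p0; rewrite (monicP mon) scale1r in def.
exists rs; first by apply/succn_inj; rewrite -(size_prod_XsubC rs id) -def size_XnsubC.
move=> x; have := congr1 (horner^~ x) def.
rewrite hornerD hornerN hornerC hornerXn horner_prod => ->.
by apply: eq_bigr => z _; rewrite hornerXsubC.
Qed.

(** A product of distances to points outside a closed set is bounded away from
    zero on that set, so good approximate roots force an actual root. *)
Lemma root_in_complete (R : realType) (L : closedFieldType) (v : L -> \bar R)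
    p E b rho : is_valuation v -> prime p -> v p%:R = 1%:E ->
  subfield E -> complete_set v E -> E b ->
  p%:R / (p%:R - 1) < rho -> (rho%:E <= v (b - 1)%R)%E ->
  exists2 y, E y & y ^+ p = b.
Proof.
move=> hv pp vp subE cE Eb rho_gt vb; apply: contrapT => noroot.
have [rs _ rsP] := XnsubC_roots b (prime_gt0 pp).
have : forall z, z \in rs -> ~ E z.
  move=> z zrs Ez; apply: noroot; exists z => //; apply/eqP.
  by rewrite -subr_eq0 rsP prodf_seq_eq0; apply/hasP; exists z => //=; rewrite subrr.
move=> rsE; have [M far] : exists M : R, forall w, E w ->
    ~ (M%:E <= v (\prod_(z <- rs) (w - z))%R)%E.
  elim: rs rsE {rsP} => [|z rs IHrs] rsE.
    by exists 1 => w _; rewrite big_nil (val1 hv) lee_fin ler10.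
  have [M1 far1] := complete_far hv cE (rsE z (mem_head z rs)).
  have [|M2 far2] := IHrs; first by move=> x xrs; apply: rsE; rewrite inE xrs orbT.
  exists (M1 + M2) => w Ew; rewrite big_cons (valuationM hv) -opprB (valN hv).
  have [t1 -> l1] := vge_lt hv (far1 w Ew).
  have [t2 -> l2] := vge_lt hv (far2 w Ew).
  by rewrite -EFinD lee_fin; lra.
have [y Ey] := root_approx hv pp vp subE Eb rho_gt vb M.
by rewrite -opprB (valN hv) rsP; apply: far.
Qed.

Lemma complete_Qp (R : realType) (p : nat) (Qp : fieldType) (vp : Qp -> \bar R)
    (L : fieldType) (v : L -> \bar R) (phi : {rmorphism Qp -> L}) :
  is_Qp p vp -> (forall x, v (phi x) = vp x) -> complete_set v (range phi).
Proof.
move=> hQp vphi u uQ cu.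
have /choice[w wu] : forall n, exists w, phi w = u n.
  by move=> n; have [w _ wP] := uQ n; exists w.
have vw m n : vp (w m - w n) = v (u m - u n) by rewrite -vphi rmorphB !wu.
have [|l wl] := Qp_complete hQp (u := w).
  move=> M; have [N uN] := cu M; exists N => m n Nm Nn.
  by rewrite vw; apply: uN.
exists (phi l); first by exists l.
move=> M; have [N wN] := wl M; exists N => n /wN.
by rewrite -vphi rmorphB wu.
Qed.

Lemma Qp_val_prime (R : realType) (p : nat) (Qp : fieldType)
    (vp : Qp -> \bar R) : prime p -> is_Qp p vp -> vp p%:R = 1%:E.
Proof.
move=> pp hQp; have := Qp_rat hQp p%:R; rewrite ratr_nat => ->.
rewrite /padic_val pnatr_eq0 gtn_eqF ?prime_gt0 //=.
rewrite (pmulrn 1 p) numq_int denq_int /= logn1 subr0.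
by rewrite -{2}[p]expn1 pfactorK.
Qed.

Lemma complete_finite_ext (R : realType) (p : nat) (Qp : fieldType)
    (vp : Qp -> \bar R) (K : fieldExtType Qp) (L : fieldType)
    (iota : {rmorphism K -> L}) (v : L -> \bar R) (E : set L) (N : nat) :
  is_Qp p vp -> is_valuation v ->
  (forall x : Qp, v (iota (in_alg K x)) = vp x) ->
  degree_le iota E N -> complete_set v E.
Proof.
move=> hQp hv hvp [_ _ [s _ ->]].
apply: complete_span; [exact: hv|exact: subfield_range|].
pose phi : {rmorphism Qp -> L} := iota \o in_alg K.
have -> : range iota = span (range phi) (map iota (vbasis {:K})).
  apply/seteqP; split=> x.
    move=> [y _ <-]; rewrite (coord_vbasis (memvf y)) rmorph_sum.
    apply: span_sum => [|i]; first exact: subfield_range.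
    rewrite -mulr_algl rmorphM; apply: spanZ; first exact: subfield_range.
      by exists (coord (vbasis {:K}) i y).
    apply: span_mem; first exact: subfield_range.
    by apply/map_f/mem_nth; rewrite size_tuple.
  apply: span_sub.
  - by exists 0 => //; rewrite rmorph0.
  - by move=> _ _ [y _ <-] [z _ <-]; exists (y + z) => //; rewrite rmorphD.
  move=> _ _ [a _ <-] /mapP[b _ ->]; exists (in_alg K a * b) => //.
  by rewrite rmorphM.
apply: complete_span; [exact: hv|exact: subfield_range|].
exact: complete_Qp hQp hvp.
Qed.

(** * Iterated preimages *)

(** The factorization [f^k(X) - b = \prod (X - z)] at the level of functions;
    the list records the [p ^ k] preimages with multiplicity. *)
Lemma iter_roots (L : closedFieldType) p (c b : L) k : (0 < p)%N ->
  exists2 rs : seq L, size rs = (p ^ k)%N &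
    forall x, iter k (unicritical p c) x - b = \prod_(z <- rs) (x - z).
Proof.
move=> p0; have /choice[rt rtP] : forall w : L, exists rs : seq L,
    size rs = p /\ forall x, x ^+ p - w = \prod_(z <- rs) (x - z).
  by move=> w; have [rs szrs rsP] := XnsubC_roots w p0; exists rs.
elim: k => [|k [rs szrs rsP]].
  by exists [:: b] => // x; rewrite big_seq1.
exists (flatten [seq rt (c + z) | z <- rs]).
  rewrite expnSr -szrs; elim: rs {szrs rsP} => //= z rs IHrs.
  by rewrite size_cat IHrs (rtP _).1 mulSn.
move=> x; rewrite iterSr rsP big_flatten /= big_map; apply: eq_bigr => z _.
by rewrite -(rtP _).2 /unicritical opprD addrA.
Qed.

Lemma iter_rootsP (L : closedFieldType) p (c b : L) k (rs : seq L) :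
  (forall x, iter k (unicritical p c) x - b = \prod_(z <- rs) (x - z)) ->
  forall x, x \in rs <-> iter k (unicritical p c) x = b.
Proof.
move=> rsP x; rewrite (rwP eqP) -subr_eq0 rsP prodf_seq_eq0; split.
  by move=> xrs; apply/hasP; exists x; rewrite //= subrr.
by move=> /hasP[z zrs]; rewrite /= subr_eq0 => /eqP ->.
Qed.

Lemma adjoin_subfield (K L : fieldType) (iota : {rmorphism K -> L}) S :
  subfield (adjoin iota S).
Proof.
split=> [W [/subfieldP subW _]|x y Sx Sy W WP|x y Sx Sy W WP].
- exact: subfield1.
- have [/subfieldP subW _] := WP; apply: subfieldB => //; [exact: Sx|exact: Sy].
- have [/subfieldP subW _] := WP; apply: subfieldV => //; [exact: Sx|exact: Sy].
Qed.

Section Tower.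
Variables (K : fieldType) (L : closedFieldType) (iota : {rmorphism K -> L}).
Hypothesis alg : forall x, algebraicOver iota x.
Variables (p : nat) (c a : K).
Hypothesis pp : prime p.
Let f := unicritical p (iota c).
Let Kn n := preimage_field iota p n c a.

Let p0 : (0 < p)%N := prime_gt0 pp.

Lemma Kn_subfield n : subfield (Kn n).
Proof. exact: adjoin_subfield. Qed.

Lemma Kn_base n x : Kn n (iota x).
Proof. by move=> W [_]; apply; left; exists x. Qed.

Lemma Kn_preimage n z : iter n f z = iota a -> Kn n z.
Proof. by move=> fz W [_]; apply; right. Qed.

Lemma Kn_min n W : subfield W -> range iota `<=` W ->
  (forall z, iter n f z = iota a -> W z) -> Kn n `<=` W.
Proof.
move=> /subfieldP subW KW fW x; apply; split => //.
by move=> z [/KW//|/fW].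
Qed.

Lemma pth_root w : exists z : L, z ^+ p = w.
Proof.
have [[|z rs] szrs rsP] := XnsubC_roots w p0; first by move: p0; rewrite -szrs.
by exists z; apply/eqP; rewrite -subr_eq0 rsP big_cons subrr mul0r.
Qed.

Lemma Kn_leq i j : (i <= j)%N -> Kn i `<=` Kn j.
Proof.
move=> /subnK <-; elim: (j - i)%N => [//|k IHk]; apply: subset_trans IHk _.
rewrite addSn; apply: Kn_min; [exact: Kn_subfield| |].
  by move=> _ [x _ <-]; apply: Kn_base.
move=> z fz; have [w wz] := pth_root (z + iota c).
have zw : z = f w by rewrite /f /unicritical wz addrK.
rewrite zw; apply: (subfieldB (Kn_subfield _)).
  apply: (subfieldX (Kn_subfield _)).
  by apply: Kn_preimage; rewrite iterSr -zw.
exact: Kn_base.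
Qed.

Lemma Kn0_degree : degree_le iota (Kn 0) 1.
Proof.
suff -> : Kn 0 = range iota by apply: degree_le_base.
apply/seteqP; split=> [|_ [x _ <-]]; last exact: Kn_base.
by apply: Kn_min => // [|z /= ->]; [exact: subfield_range|exists a].
Qed.

(** Any preimages of level [n.+1] that generate all the others over [K_n] bound
    the growth of the degree, since their [p]-th powers are in [K_n]. *)
Lemma Kn_step n N (zs : seq L) :
  (forall z, z \in zs -> iter n.+1 f z = iota a) ->
  (forall W, subfield W -> Kn n `<=` W -> (forall z, z \in zs -> W z) ->
    forall z, iter n.+1 f z = iota a -> W z) ->
  degree_le iota (Kn n) N -> degree_le iota (Kn n.+1) (N * p ^ size zs).
Proof.
move=> fzs gen KnN.
have [z /fzs fz|E [EN KE Ezs Emin]] := degree_le_roots alg (zs := zs) KnN p0.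
  rewrite -[z ^+ p](subrK (iota c)).
  apply: (subfieldD (Kn_subfield _)); last exact: Kn_base.
  by apply: Kn_preimage; rewrite -iterSr.
suff -> : Kn n.+1 = E by [].
have [subE baseE _] := EN.
apply/seteqP; split; first by apply: Kn_min => //; apply: gen.
apply: Emin; [exact: Kn_subfield|exact: Kn_leq|].
by move=> z /fzs; apply: Kn_preimage.
Qed.

Lemma Kn_step_all n N : degree_le iota (Kn n) N ->
  degree_le iota (Kn n.+1) (N * p ^ (p ^ n.+1)).
Proof.
have [rs <- rsP] := iter_roots (iota c) (iota a) n.+1 p0.
have rsE := iter_rootsP rsP.
by apply: Kn_step => [z /rsE //|W _ _ Wrs z /rsE]; apply: Wrs.
Qed.

(** The [p] solutions of [z ^+ p = c + a] are distinct, and the quotient of two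
    of them is a nontrivial root of unity. *)
Lemma Kn_root_of_unity n : (0 < n)%N ->
  distinct_preimages p 1 (iota c) (iota a) ->
  exists2 zeta, Kn n zeta & p.-primitive_root zeta.
Proof.
move=> n0 [rs urs]; rewrite /= /unicritical -addrA -opprD -rmorphD /= => rsP.
have szrs : size rs = p.
  by apply/succn_inj; rewrite -(size_prod_XsubC rs id) -rsP size_XnsubC.
have rsK z : z \in rs -> z ^+ p = iota c + iota a /\ Kn n z.
  move=> zrs; have zp : z ^+ p = iota c + iota a.
    apply/eqP; rewrite -subr_eq0; have := congr1 (horner^~ z) rsP.
    rewrite hornerD hornerN hornerC hornerXn => ->.
    by rewrite -rootE root_prod_XsubC.
  split => //; apply: (Kn_leq n0); apply: Kn_preimage => /=.
  by rewrite /f /unicritical zp addrC addKr.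
case: rs urs rsK szrs {rsP} => [|x [|y rs]] urs rsK szrs; first by move: p0; rewrite -szrs.
  by move: pp; rewrite -szrs.
have [xp Kx] := rsK x (mem_head _ _).
have [yp Ky] : y ^+ p = iota c + iota a /\ Kn n y.
  by apply: rsK; rewrite !inE eqxx orbT.
have xy : x != y by move: urs; rewrite /= inE negb_or => /andP[/andP[]].
have yn0 : y != 0.
  apply: contraNneq xy => y0; move: xp; rewrite -yp y0 expr0n gtn_eqF //=.
  by move=> /eqP; rewrite expf_eq0 => /andP[].
exists (x / y); first exact: (subfieldV (Kn_subfield _)).
have zp : (x / y) ^+ p = 1 by rewrite expr_div_n xp -yp mulfV // expf_neq0.
have [q qz qp] := prim_order_exists p0 zp.
have [_ /(_ q qp)/orP[]/eqP q1] := primeP pp; last by rewrite -q1.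
move: (prim_expr_order qz); rewrite q1 expr1 => /(canRL (mulfVK yn0)).
by rewrite mul1r => /eqP; rewrite (negPf xy).
Qed.


End Tower.

(** * Relations modulo p-th powers in the fibres of the iterates *)

Section Valuations.
Variables (R : realType) (L : closedFieldType) (v : L -> \bar R).
Hypothesis hv : is_valuation v.
Variables (p : nat) (c : L) (s : R).
Hypotheses (pp : prime p) (s0 : 0 < s) (vc : v c = (- s)%:E).
Let f := unicritical p c.

(** The truncated subtraction makes the bound stabilize at [- s = v c] from
    level [m] on. *)
Lemma preimage_val a m j b : ((- (s * (p ^ m)%:R))%:E <= v a)%E ->
  iter j f b = a -> ((- (s * (p ^ (m - j))%:R))%:E <= v b)%E.
Proof.
move=> va; elim: j b => [|j IHj] b; first by move=> /= ->; rewrite subn0.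
rewrite iterSr => /IHj vfb; apply: contrapT => /(vge_lt hv)[t vb].
have pmj : (p ^ (m - j) <= p * p ^ (m - j.+1))%N.
  by rewrite -expnS leq_exp2l ?prime_gt1 //; lia.
have : ((- (s * (p ^ (m - j))%:R))%:E <= v (b ^+ p))%E.
  rewrite -[b ^+ p](subrK c); apply: vgeD => //.
  rewrite vc lee_fin lerN2 ler_pMr // ler1n expn_gt0 prime_gt0 //.
rewrite (valX hv _ vb) lee_fin; move: pmj; rewrite -(ler_nat R) natrM.
set X := (_ ^ _)%:R; set Y := (_ ^ _)%:R => XY tp tb.
have sXY : s * X <= s * (p%:R * Y) by rewrite ler_pM2l.
have : t * p%:R < - (s * Y) * p%:R by rewrite ltr_pM2r ?ltr0n ?prime_gt0.
by lra.
Qed.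

(** The critical orbit escapes: each [p]-th power dominates [c]. *)
Lemma critical_val k : v (iter k.+1 f 0) = (- (s * p%:R ^+ k))%:E.
Proof.
elim: k => [|k IHk].
  by rewrite /= /f /unicritical expr0n gtn_eqF ?prime_gt0 // sub0r valN // vc mulr1.
rewrite iterS {1}/f /unicritical.
have vA := valX hv p IHk; rewrite valD_lt // vA; last first.
  rewrite valN // vc lte_fin mulNr ltrN2 -mulrA -exprSr ltr_pMr //.
  by rewrite exprn_egt1 // ltr1n prime_gt1.
by rewrite mulNr -mulrA -exprSr.
Qed.

(** The product is [+- (f^r(- c) - b) = +- (A ^+ p - d ^+ p)] with
    [A = f^r(0)], because [- c = f 0]; and [1 - (d / A) ^+ p] is close enough
    to 1 to be a [p]-th power in [E]. *)
Lemma fiber_product_root r E b d (rs : seq L) : (0 < r)%N -> v p%:R = 1%:E ->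
  p%:R / ((p%:R ^+ r - 1) * (p%:R - 1)) < s ->
  subfield E -> complete_set v E -> E c -> E d -> d ^+ p = c + b ->
  ((- s)%:E <= v b)%E -> size rs = (p ^ r)%N ->
  (forall x, iter r f x - b = \prod_(z <- rs) (x - z)) ->
  exists h, [/\ E h, h != 0 & h ^+ p = \prod_(z <- rs) (c + z)].
Proof.
move=> r0 vp sgt subE cE Ec Ed db vb szrs rsP.
case: r r0 sgt szrs rsP => // q _ sgt szrs rsP.
set A := iter q.+1 f 0.
have vA : v A = (- (s * p%:R ^+ q))%:E := critical_val q.
have An0 : A != 0 by apply/eqP => A0; move: vA; rewrite A0 (valuation0 hv).
have EA : E A.
  rewrite /A; elim: (q.+1) => [|k IHk]; first exact: subfield0.
  by rewrite iterS; apply: (subfieldB subE) => //; apply: subfieldX.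
(* [rho] is the valuation of [A ^- p] plus the lower bound [- s] of that of [d ^+ p]. *)
pose rho := s * (p%:R ^+ q.+1 - 1).
have p1 : 1 < p%:R :> R by rewrite ltr1n prime_gt1.
have pq1 : 1 < p%:R ^+ q.+1 :> R by rewrite exprn_egt1.
have rho_gt : p%:R / (p%:R - 1) < rho.
  rewrite /rho -ltr_pdivrMr ?subr_gt0 //; move: sgt.
  by rewrite invfM mulrA mulrAC.
have rho0 : 0 < rho by rewrite mulr_gt0 // subr_gt0.
pose b1 := 1 - (d / A) ^+ p.
have vb1 : (rho%:E <= v (b1 - 1)%R)%E.
  have -> : b1 - 1 = - (d / A) ^+ p by rewrite /b1; ring.
  rewrite valN // expr_div_n db.
  have -> : rho = - s + - (- (s * p%:R ^+ q) * p%:R).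
    by rewrite /rho exprSr; ring.
  apply: vgeM => //; last by rewrite (valV hv (valX hv p vA)).
  by apply: vgeD => //; rewrite vc.
have [|y Ey yb1] := root_in_complete hv pp vp subE cE _ rho_gt vb1.
  apply: (subfieldB subE); first exact: subfield1.
  by apply: subfieldX => //; apply: (subfieldV subE).
have b1n0 : b1 != 0.
  apply/eqP => b10; move: vb1; rewrite b10 sub0r valN // val1 // lee_fin; lra.
have E1 : E (-1) by apply: subfieldN => //; apply: subfield1.
(* The sign [(-1) ^+ size rs] is a power of exponent [p] because [size rs = p ^ q * p]. *)
exists ((-1) ^+ (p ^ q) * A * y); split.
- by apply: subfieldM => //; apply: subfieldM => //; apply: subfieldX.
- apply: mulf_neq0; last by apply: contraNneq b1n0 => y0; rewrite -yb1 y0 expr0n gtn_eqF ?prime_gt0.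
  by rewrite mulf_neq0 // signr_eq0.
have -> : \prod_(z <- rs) (c + z) = (-1) ^+ size rs * \prod_(z <- rs) (- c - z).
  elim: (rs) => [|z zs IHzs]; first by rewrite !big_nil mulr1.
  by rewrite !big_cons IHzs /= exprS; ring.
rewrite -rsP szrs !exprMn yb1 -exprM -expnSr -mulrA; congr (_ * _).
have -> : - c = f 0 by rewrite /f /unicritical expr0n gtn_eqF ?prime_gt0 // sub0r.
rewrite -iterSr iterS -/A /f /unicritical /b1 expr_div_n db.
by field; rewrite expf_neq0.
Qed.

End Valuations.

Lemma mem_of_pth_power (L : fieldType) (W : set L) p zeta u z : subfield W ->
  (0 < p)%N -> p.-primitive_root zeta -> W zeta -> W u -> z ^+ p = u ^+ p -> W z.
Proof.
move=> subW p0 prim Wzeta Wu zu; have [u0|un0] := eqVneq u 0.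
  suff -> : z = 0 by apply: subfield0.
  by apply/eqP; move: zu => /eqP; rewrite u0 expr0n gtn_eqF // expf_eq0 p0.
have [|i zi] := prim_rootP prim (x := z / u).
  by rewrite expr_div_n zu mulfV // expf_neq0.
rewrite -[z](mulfVK un0) zi; apply: subfieldM => //; exact: subfieldX.
Qed.

Section Saving.
Variables (K : fieldType) (L : closedFieldType) (iota : {rmorphism K -> L}).
Hypothesis alg : forall x, algebraicOver iota x.
Variables (R : realType) (v : L -> \bar R).
Hypothesis hv : is_valuation v.
Hypothesis complete_ext : forall E N, degree_le iota E N -> complete_set v E.
Variables (p r m : nat) (c a : K) (s : R).
Hypotheses (pp : prime p) (r0 : (0 < r)%N) (vp : v p%:R = 1%:E).
Hypotheses (s0 : 0 < s) (vc : v (iota c) = (- s)%:E).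
Hypothesis s_gt : p%:R / ((p%:R ^+ r - 1) * (p%:R - 1)) < s.
Hypothesis va : ((- (s * (p ^ m)%:R))%:E <= v (iota a))%E.
Hypothesis dist : distinct_preimages p 1 (iota c) (iota a).
Let f := unicritical p (iota c).
Let Kn n := preimage_field iota p n c a.
Let p0 : (0 < p)%N := prime_gt0 pp.

Lemma fiber_product_Kn n b (rs : seq L) N : (m + r <= n)%N ->
  degree_le iota (Kn n) N -> iter (n - r) f b = iota a -> size rs = (p ^ r)%N ->
  (forall x, iter r f x - b = \prod_(z <- rs) (x - z)) ->
  exists h, [/\ Kn n h, h != 0 & h ^+ p = \prod_(z <- rs) (iota c + z)].
Proof.
move=> mrn KnN fb szrs rsP; have [d db] := pth_root pp (iota c + b).
apply: (fiber_product_root hv pp s0 vc r0 vp s_gt _ _ _ _ db _ szrs rsP).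
- exact: Kn_subfield.
- exact: complete_ext KnN.
- exact: Kn_base.
- have le : (n - r.-1 <= n)%N by apply: leq_subr.
  apply: (Kn_leq pp le); apply: Kn_preimage.
  have -> : (n - r.-1 = (n - r).+1)%N by lia.
  by rewrite iterSr /unicritical db addrC addKr.
have := preimage_val hv pp s0 vc va fb.
by rewrite (_ : (m - (n - r) = 0)%N) ?mulr1 //; lia.
Qed.

(** In the fibre of each [b] under [f^r] all roots but one are adjoined; the
    product formula of [fiber_product_Kn] recovers the missing one. *)
Lemma Kn_step_saving n N : (m + r <= n)%N -> degree_le iota (Kn n) N ->
  degree_le iota (Kn n.+1) (N * p ^ (p ^ n - p ^ (n - r))).
Proof.
move=> mrn KnN.
have [bs szbs bsP] := iter_roots (iota c) (iota a) (n - r) p0.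
have bsE := iter_rootsP bsP.
have /choice[fib fibP] : forall b : L, exists rs : seq L, size rs = (p ^ r)%N /\
    forall x, iter r f x - b = \prod_(z <- rs) (x - z).
  by move=> b; have [rs] := iter_roots (iota c) b r p0; exists rs.
have fibE b := iter_rootsP (fibP b).2.
have /choice[rt rtP] := pth_root (L := L) pp.
have rn : (r <= n)%N by apply: leq_trans mrn; apply: leq_addl.
(* Which element of a fibre is left out is immaterial: here the head of the list. *)
pose zs := flatten [seq [seq rt (iota c + w) | w <- behead (fib b)] | b <- bs].
have szzs : size zs = (p ^ n - p ^ (n - r))%N.
  rewrite -{1}(subnK rn) expnD -{2}[(p ^ (n - r))%N]muln1 -mulnBr -szbs /zs.
  elim: (bs) => //= b bs' IHbs.
  by rewrite size_cat size_map size_behead (fibP b).1 IHbs mulSn subn1.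
have zsP b w : iter (n - r) f b = iota a -> w \in behead (fib b) ->
    rt (iota c + w) \in zs.
  move=> /bsE bbs wb; apply/flatten_mapP; exists b => //.
  exact: (map_f (fun w => rt (iota c + w))).
have [|zeta Kzeta prim] := Kn_root_of_unity pp (n := n) _ dist; first by lia.
rewrite -szzs; apply: Kn_step => // [z /flatten_mapP[b /bsE fb /mapP[w wb ->]]|].
  rewrite iterSr /unicritical rtP addrC addKr -(subnK rn) iterD.
  by rewrite ((fibE b w).1 (mem_behead wb)).
move=> W subW KW zsW z; rewrite iterSr => fz.
set w := unicritical p (iota c) z in fz.
have zw : z ^+ p = iota c + w by rewrite /w /unicritical addrC subrK.
pose b := iter r f w.
have fb : iter (n - r) f b = iota a by rewrite -iterD subnK.
have wb : w \in fib b by apply/fibE.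
have [h [Kh hn0 hp]] := fiber_product_Kn mrn KnN fb (fibP b).1 (fibP b).2.
have := zsP b ^~ fb; have := (fibP b).1.
case: (fib b) wb hp => [//|w0 ws]; rewrite inE big_cons => wws hp _ /= ws_zs.
have Wmem := mem_of_pth_power subW p0 prim (KW _ Kzeta).
move: wws => /orP[/eqP ww0|wws]; last first.
  by apply: (Wmem (rt (iota c + w))); [apply/zsW/ws_zs|rewrite rtP].
(* The root [z] left out is recovered from [(z * Z) ^+ p = h ^+ p]. *)
pose Z := \prod_(x <- ws) rt (iota c + x).
have ZP : (z * Z) ^+ p = h ^+ p.
  rewrite hp exprMn zw ww0; congr (_ * _).
  by rewrite -prodrXl; apply: eq_bigr => x _; rewrite rtP.
have Zn0 : Z != 0.
  apply: contraNneq hn0 => Z0; move: ZP; rewrite Z0 mulr0 expr0n gtn_eqF //=.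
  by move=> /esym/eqP; rewrite expf_eq0 => /andP[].
rewrite -[z](mulfK Zn0); apply: (subfieldV subW).
  by apply: Wmem ZP; apply: KW.
rewrite /Z -(big_map (fun x => rt (iota c + x)) xpredT id).
by apply: subfield_prod => // _ /mapP[x xws ->]; apply/zsW/ws_zs.
Qed.

Lemma Kn_degree n : degree_le iota (Kn n)
  ((\prod_(0 <= i < m + r) p ^ p ^ i.+1) *
    \prod_(m + r <= i < n) p ^ (p ^ i - p ^ (i - r))).
Proof.
have crude k : degree_le iota (Kn k) (\prod_(0 <= i < k) p ^ p ^ i.+1).
  elim: k => [|k IHk]; first by rewrite big_geq //; apply: Kn0_degree.
  by rewrite big_nat_recr //=; apply: Kn_step_all.
have [nm|mn] := leqP n (m + r).
  rewrite [X in (_ * X)%N]big_geq // muln1.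
  have [subE KE [t tsz eqt]] := crude n; split => //; exists t => //.
  apply: leq_trans tsz _; rewrite (big_cat_nat (n := n) _ nm) //=.
  by rewrite leq_pmulr // prodn_gt0 // => i; rewrite expn_gt0 p0.
rewrite -(subnK (ltnW mn)); elim: (n - (m + r))%N => [|k IHk].
  by rewrite [X in (_ * X)%N]big_geq // muln1; apply: crude.
rewrite addSn big_nat_recr ?leq_addl //= mulnA.
by apply: Kn_step_saving => //; apply: leq_addl.
Qed.

End Saving.

(** * The growth of the degree *)

(** Each factor is an equality: [p ^ i - p ^ (i - r) = p ^ i * (1 - p ^ - r)]
    when [r <= i]. *)
Lemma saving_bound (R : realType) p r k n : (1 < p)%N -> (r <= k)%N ->
  (\prod_(k <= i < n) p ^ (p ^ i - p ^ (i - r)))%:R <=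
    (Bn p n)%:R `^ (1 - p%:R ^- r) :> R.
Proof.
move=> p1 rk; have p0 := ltnW p1; set e := 1 - _.
have pR : 1 <= p%:R :> R by rewrite ler1n.
have e0 : 0 <= e.
  by rewrite subr_ge0 invf_le1 ?exprn_ege1 // exprn_gt0 // ltr0n.
have pos i j : (0 < \prod_(i <= l < j) p ^ p ^ l)%N.
  by rewrite prodn_gt0 // => l; rewrite expn_gt0 p0.
apply: (@le_trans _ _ ((\prod_(k <= i < n) p ^ p ^ i)%N%:R `^ e)); last first.
  apply: ge0_ler_powR => //; rewrite ?nnegrE // ler_nat /Bn.
  apply: (@leq_trans (\prod_(0 <= i < n) p ^ p ^ i)); last first.
    by rewrite leq_pmull // -ltnS prednK.
  have [kn|nk] := leqP k n; last by rewrite (big_geq (ltnW nk)) pos.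
  by rewrite [leqRHS](big_cat_nat (n := k)) //= leq_pmull.
elim: n => [|n IHn]; first by rewrite !big_geq // powR1.
have [kn|nk] := leqP k n; last by rewrite !big_geq // powR1.
rewrite !big_nat_recr //= !natrM powRM //; apply: ler_pM => //.
rewrite !natrX -!powR_mulrn ?ler0n // -powRrM le_eqVlt; apply/orP; left.
apply/eqP; congr (_ `^ _); rewrite natrB ?leq_exp2l ?leq_subr // mulrBr mulr1.
congr (_ - _); rewrite !natrX; set i := (n - r)%N.
have -> : n = (i + r)%N by rewrite /i subnK // (leq_trans rk).
by rewrite exprD mulfK // expf_neq0 // pnatr_eq0 -lt0n.
Qed.

Theorem theorem6p2 (R : realType) (p r : nat) (va : \bar R)
    (hp : prime p) (hr : (1 <= r)%N) :
  exists C : R,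
  forall (Qp : fieldType) (vp : Qp -> \bar R) (hQp : is_Qp p vp)
    (K : fieldExtType Qp)
    (L : closedFieldType) (iota : {rmorphism K -> L})
    (hL : is_algebraic_closure iota)
    (v : L -> \bar R) (hv : is_valuation v)
    (hvp : forall x : Qp, v (iota (in_alg K x)) = vp x)
    (c a : K),
    c != 0 ->
    v (iota a) = va ->
    (forall n : nat, distinct_preimages p n (iota c) (iota a)) ->
    (v (iota c) < 0)%E ->
    (v (iota c) < (- (p%:R / ((p%:R ^+ r - 1) * (p%:R - 1))))%R%:E)%E ->
    forall n : nat,
      exists2 d : nat, has_degree iota (preimage_field iota p n c a) d &
        d%:R <= C * (Bn p n)%:R `^ (1 - p%:R ^- r).
Proof.
have p1 := prime_gt1 hp; have p0 := prime_gt0 hp.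
have p2 : 2 <= p%:R :> R by rewrite ler_nat.
set theta : R := p%:R / _.
have theta0 : 0 < theta.
  by rewrite divr_gt0 ?mulr_gt0 ?subr_gt0 ?exprn_egt1 -?lt0n //; lra.
(* [theta] replaces [- v c], on which the level [m] must not depend. *)
have [m mP] : exists m, va != -oo%E -> ((- (theta * (p ^ m)%:R))%:E <= va)%E.
  case: va => [t||]; [|by exists 0%N; rewrite leey|by exists 0%N].
  have [m mP] := nat_above (- t / theta); exists m => _.
  rewrite lee_fin lerNl mulrC -ler_pdivrMr //; apply: mP.
  by apply/ltnW/ltn_expl.
exists (\prod_(0 <= i < m + r) p ^ p ^ i.+1)%N%:R.
move=> Qp vp hQp K L iota hL v hv hvp c a cn0 vaE dist vc0 vcE n.
have [t vt] : exists t, v (iota c) = t%:E.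
  by apply: (val_real hv); rewrite fmorph_eq0.
have vpp : v p%:R = 1%:E.
  by rewrite -(Qp_val_prime hp hQp) -hvp !rmorph_nat.
have va_ge : ((- (theta * (p ^ m)%:R))%:E <= v (iota a))%E.
  rewrite vaE; apply: mP; rewrite -vaE.
  have [->|/(val_real hv)[t' ->] //] := eqVneq (iota a) 0.
  by rewrite (valuation0 hv).
have theta_t : theta < - t by move: vcE; rewrite vt lte_fin ltrNr.
have [|||d dP dN] := degree_le_has (Kn_degree (s := - t) (m := m) (c := c) (a := a)
  hL hv (fun E N => complete_finite_ext hQp hv hvp) hp hr vpp _ _ theta_t _ (dist 1%N) n).
- exact: lt_trans theta0 theta_t.
- by rewrite opprK.
- by apply: le_trans va_ge; rewrite lee_fin lerN2 ler_wpM2r // ltW.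
exists d => //; move: dN; rewrite -(ler_nat R) natrM => /le_trans; apply.
by rewrite ler_wpM2l //; apply: saving_bound => //; apply: leq_addl.
Qed.
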